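(* Let $\mathbf{S}=\{A_1,\dots,A_m\}\subset\mathbb{S}^n$, $b\in\mathbb{R}^m$ and $\varepsilon\in(0,1)$. Let $R=\max\{\Vert b-p(X)\Vert: X\in\mathbf{\Delta}_n\}$. Then the Spectrahull Triangle Algorithm, in $O(1/\varepsilon^2)$ iterations (with an absolute implied constant), either computes a hyperplane in $\mathbb{R}^m$ separating $b$ from $SH(\mathbf{S})$, or computes $X_\varepsilon\in\mathbf{\Delta}_n$ such that $\Vert p(X_\varepsilon)-b\Vert\le\varepsilon R$.
   Context: $\mathbb{S}^n$ is the space of real symmetric $n\times n$ matrices with inner product $X\bullet Y=\mathrm{Tr}(XY)$. The spectraplex is $\mathbf{\Delta}_n=\{X\in\mathbb{S}^n: \mathrm{Tr}(X)=1,\ X\succeq 0\}$. For $\mathbf{S}=\{A_1,\dots,A_m\}\subset\mathbb{S}^n$, $p(X)=(A_1\bullet X,\dots,A_m\bullet X)^T\in\mathbb{R}^m$, and the spectrahull is $SH(\mathbf{S})=\{p(X): X\in\mathbf{\Delta}_n\}$. $\Vert\cdot\Vert$ is the Euclidean norm. Spectrahull Triangle Algorithm on input $(\mathbf{S},b,\varepsilon)$: Step 0: set $X'=ee^T/n$, $e=(1,\dots,1)^T\in\mathbb{R}^n$. Step 1: compute $p(X')$. Step 2: if $\Vert p(X')-b\Vert\le\varepsilon R$, output $X'$ and stop. Step 3: set $A=\sum_{i=1}^m(A_i\bullet X'-b_i)A_i$. Step 4: if there exists $V\in\mathbf{\Delta}_n$ (a pivot) with $A\bullet V\le\frac12(\Vert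 p(X')\Vert^2-\Vert b\Vert^2)$ (equivalently $\Vert p(X')-p(V)\Vert\ge\Vert b-p(V)\Vert$), take any such $V$, set $\alpha_*=\mathrm{argmin}\{\Vert(1-\alpha)p(X')+\alpha p(V)-b\Vert:\alpha\in[0,1]\}$, replace $X'$ by $(1-\alpha_* )X'+\alpha_*V$, and go to Step 1. Step 5: if no pivot exists, $X'$ is a witness: output the orthogonal bisecting hyperplane of the segment from $b$ to $p(X')$, namely $\{x\in\mathbb{R}^m:(p(X')-b)^Tx=\frac12(\Vert p(X')\Vert^2-\Vert b\Vert^2)\}$, and stop. An iteration is one pass through Steps 1–4. *)

(* Defs.v *)
From mathcomp Require Import all_boot all_order all_algebra.
From mathcomp Require Import all_classical all_reals all_analysis.
From mathcomp Require Import ring lra.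

Set Implicit Arguments.
Unset Strict Implicit.
Unset Printing Implicit Defensive.

Import Order.TTheory GRing.Theory Num.Theory.
Import numFieldNormedType.Exports.

Local Open Scope classical_set_scope.
Local Open Scope ring_scope.

Section Definitions.
Variable R : realType.

Definition dotv (m : nat) (u v : 'cV[R]_m) : R := \sum_(i < m) u i 0 * v i 0.

(* The library norm `|u| on matrices is the sup norm. *)
Definition enorm (m : nat) (u : 'cV[R]_m) : R := Num.sqrt (dotv u u).

Definition mxdot (n : nat) (X Y : 'M[R]_n) : R := \tr (X *m Y).

Definition psdmx (n : nat) (X : 'M[R]_n) : Prop :=
  X \is symmetricmx /\ forall x : 'cV[R]_n, 0 <= (x^T *m X *m x) 0 0.

Definition spectraplex (n : nat) : set 'M[R]_n :=
  [set X | \tr X = 1 /\ psdmx X].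

Definition pvec (m n : nat) (S : 'I_m -> 'M[R]_n) (X : 'M[R]_n) : 'cV[R]_m :=
  \col_(i < m) mxdot (S i) X.

Definition spectrahull (m n : nat) (S : 'I_m -> 'M[R]_n) : set 'cV[R]_m :=
  pvec S @` @spectraplex n.

Definition is_max (E : set R) (r : R) : Prop := E r /\ ubound E r.

Definition is_radius (m n : nat) (S : 'I_m -> 'M[R]_n) (b : 'cV[R]_m)
    (rho : R) : Prop :=
  is_max [set enorm (b - pvec S X) | X in @spectraplex n] rho.

Definition hyperplane (m : nat) (a : 'cV[R]_m) (c : R) : set 'cV[R]_m :=
  [set x | dotv a x = c].

(* Strict separation; replacing (a, c) by (- a, - c) shows that fixing the side
   on which b lies is no restriction. *)
Definition separating_hyperplane (m : nat) (H : set 'cV[R]_m) (b : 'cV[R]_m)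
    (K : set 'cV[R]_m) : Prop :=
  exists (a : 'cV[R]_m) (c : R),
    [/\ a != 0, H = hyperplane a c, dotv a b < c
      & forall y, K y -> c < dotv a y].

Inductive config (m n : nat) : Type :=
  | Iterate of 'M[R]_n
  | Solution of 'M[R]_n
  | Separator of set 'cV[R]_m.

Arguments Iterate {m n}.
Arguments Solution {m n}.
Arguments Separator {m n}.

Section Algorithm.
Variables (m n : nat) (S : 'I_m -> 'M[R]_n) (b : 'cV[R]_m) (tol : R).

Definition init_iterate : 'M[R]_n :=
  let e : 'cV[R]_n := const_mx 1 in n%:R^-1 *: (e *m e^T).

Definition pivot_mx (X : 'M[R]_n) : 'M[R]_n :=
  \sum_(i < m) (mxdot (S i) X - b i 0) *: S i.

Definition is_pivot (X V : 'M[R]_n) : Prop :=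
  spectraplex V /\
  mxdot (pivot_mx X) V <= 2^-1 * (enorm (pvec S X) ^+ 2 - enorm b ^+ 2).

Definition is_step_size (X V : 'M[R]_n) (alpha : R) : Prop :=
  let f (t : R) := enorm ((1 - t) *: pvec S X + t *: pvec S V - b) in
  0 <= alpha <= 1 /\ forall beta : R, 0 <= beta <= 1 -> f alpha <= f beta.

Definition bisector (X : 'M[R]_n) : set 'cV[R]_m :=
  hyperplane (pvec S X - b) (2^-1 * (enorm (pvec S X) ^+ 2 - enorm b ^+ 2)).

(* [pass X c]: a single pass through the loop, started at the iterate X, can
   lead to c.  It is a relation because the pivot is an arbitrary one. *)
Inductive pass (X : 'M[R]_n) : config m n -> Prop :=
  | pass_solution :
      enorm (pvec S X - b) <= tol -> pass X (Solution X)
  | pass_pivot (V : 'M[R]_n) (alpha : R) :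
      ~ (enorm (pvec S X - b) <= tol) ->
      is_pivot X V -> is_step_size X V alpha ->
      pass X (Iterate ((1 - alpha) *: X + alpha *: V))
  | pass_witness :
      ~ (enorm (pvec S X - b) <= tol) ->
      ~ (exists V, is_pivot X V) -> pass X (Separator (bisector X)).

(* [run k c]: some execution is in configuration c after exactly k passes, the
   pass that halts being counted. *)
Inductive run : nat -> config m n -> Prop :=
  | run_start : run 0 (Iterate init_iterate)
  | run_pass (k : nat) (X : 'M[R]_n) (c : config m n) :
      run k (Iterate X) -> pass X c -> run k.+1 c.

End Algorithm.

End Definitions.

Arguments Iterate {R m n}.
Arguments Solution {R m n}.
Arguments Separator {R m n}.

Section RadiusExists.
Variables (R : realType) (m n : nat) (S : 'I_m -> 'M[R]_n) (b : 'cV[R]_m).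

Let csum k (F : 'I_k -> 'rV[R]_(n * n) -> R) :
  (forall i, continuous (F i)) -> continuous (fun v => \sum_(i < k) F i v).
Proof.
by move=> cF; apply: continuous_big => // w; exact: (@tvs.add_continuous R).
Qed.

Let cmul (f g : 'rV[R]_(n * n) -> R) :
  continuous f -> continuous g -> continuous (fun v => f v * g v).
Proof. by move=> cf cg v; exact: (continuousM (cf v) (cg v)). Qed.

Let csub (f g : 'rV[R]_(n * n) -> R) :
  continuous f -> continuous g -> continuous (fun v => f v - g v).
Proof. by move=> cf cg v; exact: (continuousB (cf v) (cg v)). Qed.

Let ccst (r : R) : continuous (fun _ : 'rV[R]_(n * n) => r).
Proof. by move=> v; exact: cst_continuous. Qed.

Let vcoord_cont i j : continuous (fun v : 'rV[R]_(n * n) => vec_mx v i j).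
Proof. by under eq_fun do rewrite mxE; exact: coord_continuous. Qed.

Let quad_cont (x : 'cV[R]_n) :
  continuous (fun v : 'rV[R]_(n * n) => (x^T *m vec_mx v *m x) 0 0).
Proof.
under eq_fun do rewrite mxE.
apply: csum => j; apply: cmul; last exact: ccst.
under eq_fun do rewrite mxE.
by apply: csum => i; apply: cmul; [exact: ccst | exact: vcoord_cont].
Qed.

Let tr_cont : continuous (fun v : 'rV[R]_(n * n) => \tr (vec_mx v)).
Proof. by apply: csum => i; exact: vcoord_cont. Qed.

Let obj_cont :
  continuous (fun v : 'rV[R]_(n * n) => enorm (b - pvec S (vec_mx v))).
Proof.
have cp i : continuous (fun v : 'rV[R]_(n * n) => (b - pvec S (vec_mx v)) i 0).
  under eq_fun do rewrite !mxE; apply: csub; first exact: ccst.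
  apply: csum => k; under eq_fun do rewrite mxE.
  by apply: csum => j; apply: cmul; [exact: ccst | exact: vcoord_cont].
have cd : continuous (fun v : 'rV[R]_(n * n) =>
    dotv (b - pvec S (vec_mx v)) (b - pvec S (vec_mx v))).
  by apply: csum => i; exact: cmul.
by move=> v; exact: (continuous_comp (cd v) (@sqrt_continuous R _)).
Qed.

Let entry_le1 (X : 'M[R]_n) i j : spectraplex X -> `|X i j| <= 1.
Proof.
move=> [trX [/is_hermitianmxP symX pX]].
have symE k l : X k l = X l k by rewrite {1}symX expr0 scale1r !mxE.
have quadE (c : R) :
    (((delta_mx i 0 + c *: delta_mx j 0)^T : 'rV[R]_n) *m X
       *m (delta_mx i 0 + c *: delta_mx j 0 : 'cV[R]_n)) 0 0
    = X i i + c * X i j + c * (X j i + c * X j j).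
  have -> : (delta_mx i 0 + c *: delta_mx j 0 : 'cV[R]_n)^T =
      delta_mx 0 i + c *: delta_mx 0 j.
    by rewrite raddfD /= linearZ /= !trmx_delta.
  rewrite !mulmxDl !mulmxDr -!scalemxAl.
  by rewrite -!scalemxAr -!rowE -!colE !mxE; ring.
have diag_ge0 k : 0 <= X k k.
  by have := pX (delta_mx k 0); rewrite trmx_delta -rowE -colE !mxE.
have diag_le1 k : X k k <= 1.
  by rewrite -trX /mxtrace (bigD1 k) //= lerDl sumr_ge0.
have := pX (delta_mx i 0 + 1 *: delta_mx j 0).
have := pX (delta_mx i 0 + (-1) *: delta_mx j 0).
rewrite !quadE (symE j i) ler_norml.
by have := diag_le1 i; have := diag_le1 j; move=> *; apply/andP; split; lra.
Qed.

(* The maximum defining the radius is attained. *)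
Lemma radius_exists : (0 < n)%N -> exists rho, is_radius S b rho.
Proof.
move=> n_gt0.
pose A : set 'rV[R]_(n * n) := [set v | spectraplex (vec_mx v)].
have A0 : A !=set0.
  exists (mxvec (delta_mx (Ordinal n_gt0) (Ordinal n_gt0))).
  rewrite /A /= mxvecK; split; last split.
  - rewrite /mxtrace (bigD1 (Ordinal n_gt0)) //= mxE !eqxx big1 ?addr0 //.
    by move=> k /negPf kN; rewrite mxE kN.
  - by apply/is_hermitianmxP; rewrite expr0 scale1r map_mx_id // trmx_delta.
  - move=> x; rewrite -(mul_delta_mx (0 : 'I_1)) mulmxA -mulmxA.
    by rewrite mxE big_ord1 -colE -rowE !mxE; exact: sqr_ge0.
have cA : compact A.
  apply: bounded_closed_compact.
    exists 1; split => // M M1 v /= Av.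
    rewrite [leLHS]/Num.norm /= mx_normrE; apply: bigmax_le => [|[i j] _ /=].
      by apply: ltW; apply: lt_trans M1.
    apply: le_trans (ltW M1); rewrite (ord1 i).
    case: j / (mxvec_indexP j) => k l.
    by have := entry_le1 k l Av; rewrite mxE.
  have -> : A = [set v | \tr (vec_mx v) = 1] `&`
      (\bigcap_(ij in @setT ('I_n * 'I_n))
         [set v | vec_mx v ij.1 ij.2 - vec_mx v ij.2 ij.1 = 0] `&`
       \bigcap_(x in @setT 'cV[R]_n)
         [set v | 0 <= (x^T *m vec_mx v *m x) 0 0]).
    apply/seteqP; split => v /=.
      move=> [? [/is_hermitianmxP sv pv]]; split=> //; split=> [[i j] _ /=|x _ /=].
        by rewrite {1}sv expr0 scale1r !mxE subrr.
      exact: pv.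
    move=> [? [sv pv]]; split=> //; split; last by move=> x; exact: pv.
    apply/is_hermitianmxP; rewrite expr0 scale1r; apply/matrixP => i j.
    by have /eqP := sv (i, j) I; rewrite subr_eq0 => /eqP; rewrite !mxE.
  have cpre (f : 'rV[R]_(n * n) -> R) (D : set R) :
      continuous f -> closed D -> closed (f @^-1` D).
    by move=> cf cD; apply: preimage_closed => // v _; exact: cf.
  apply: closedI; first exact: (cpre _ [set r | r = 1] tr_cont (@closed_eq R 1)).
  apply: closedI.
    apply: closed_bigI => -[i j] _ /=.
    exact: (cpre _ [set r | r = 0] (csub (@vcoord_cont i j) (@vcoord_cont j i))
              (@closed_eq R 0)).
  apply: closed_bigI => x _.
  exact: (cpre _ [set r | 0 <= r] (@quad_cont x) (@closed_ge R 0)).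
have [v vA vmax] := compact_EVT_max A0 cA (continuous_subspaceT obj_cont).
rewrite inE in vA.
exists (enorm (b - pvec S (vec_mx v))); split; first by exists (vec_mx v).
move=> _ [X sX <-]; rewrite -(mxvecK X).
by apply: vmax; rewrite inE /A /= mxvecK.
Qed.

End RadiusExists.

(* Main.v *)
Require Import Defs.
From mathcomp Require Import all_boot all_order all_algebra.
From mathcomp Require Import all_classical all_reals all_analysis.
From mathcomp Require Import ring lra.

Set Implicit Arguments.
Unset Strict Implicit.
Unset Printing Implicit Defensive.

Import Order.TTheory GRing.Theory Num.Theory.

Local Open Scope classical_set_scope.
Local Open Scope ring_scope.

(** Write u = p(X') - b and v = p(V) - b.  The pivot inequality says exactly
    u.v <= |u|^2 / 2, so |(1 - t) u + t v|^2 <= (1 - t) |u|^2 + t^2 rho^2 on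
    [0, 1].  At t = |u|^2 / (2 rho^2) this shows that d = |u|^2 / rho^2 drops to
    at most d - d^2 / 4 in a pass; hence 1/d grows by at least 1/4 per pass, and
    d > eps^2 can hold for fewer than 4 / eps^2 passes.  When there is no pivot,
    u.p(V) exceeds the bisector level for every V of the spectraplex, while
    u.b lies |u|^2 / 2 below it. *)

(** * Euclidean inner product and norm *)

Section EuclideanNorm.
Variables (R : realType) (m : nat).
Implicit Types (u v w : 'cV[R]_m) (a : R).

Lemma dotvC u v : dotv u v = dotv v u.
Proof. by apply: eq_bigr => i _; rewrite mulrC. Qed.

Lemma dotvDl u v w : dotv (u + v) w = dotv u w + dotv v w.
Proof. by rewrite -big_split; apply: eq_bigr => i _; rewrite mxE mulrDl. Qed.

Lemma dotvZl a u w : dotv (a *: u) w = a * dotv u w.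
Proof. by rewrite mulr_sumr; apply: eq_bigr => i _; rewrite mxE mulrA. Qed.

Lemma dotvNl u w : dotv (- u) w = - dotv u w.
Proof. by rewrite -scaleN1r dotvZl mulN1r. Qed.

Lemma dotvDr u v w : dotv w (u + v) = dotv w u + dotv w v.
Proof. by rewrite dotvC dotvDl !(dotvC w). Qed.

Lemma dotvZr a u w : dotv w (a *: u) = a * dotv w u.
Proof. by rewrite dotvC dotvZl dotvC. Qed.

Lemma dotvNr u w : dotv w (- u) = - dotv w u.
Proof. by rewrite dotvC dotvNl dotvC. Qed.

Lemma dotvv_ge0 u : 0 <= dotv u u.
Proof. by apply: sumr_ge0 => i _; rewrite -expr2 sqr_ge0. Qed.

Lemma enorm_ge0 u : 0 <= enorm u.
Proof. exact: sqrtr_ge0. Qed.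

Lemma sqr_enorm u : enorm u ^+ 2 = dotv u u.
Proof. by rewrite sqr_sqrtr ?dotvv_ge0. Qed.

Lemma enorm0 : enorm (0 : 'cV[R]_m) = 0.
Proof. by rewrite /enorm -(scale0r (0 : 'cV[R]_m)) dotvZl mul0r sqrtr0. Qed.

Lemma enormN u : enorm (- u) = enorm u.
Proof. by rewrite /enorm dotvNl dotvNr opprK. Qed.

Lemma ler_enorm u v : (enorm u <= enorm v) = (dotv u u <= dotv v v).
Proof. by rewrite ler_sqrt ?dotvv_ge0. Qed.

Lemma dotv_segment (t : R) u v :
  dotv ((1 - t) *: u + t *: v) ((1 - t) *: u + t *: v) =
  (1 - t) ^+ 2 * dotv u u + 2 * t * (1 - t) * dotv u v + t ^+ 2 * dotv v v.
Proof. by rewrite !(dotvDl, dotvDr, dotvZl, dotvZr) (dotvC v u); ring. Qed.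

Lemma segment_subr (t : R) u v w :
  (1 - t) *: u + t *: v - w = (1 - t) *: (u - w) + t *: (v - w).
Proof. by apply/matrixP => i j; rewrite !mxE; ring. Qed.

End EuclideanNorm.

(** * Convexity of the spectraplex and membership of the starting point *)

Section Spectraplex.
Variables (R : realType) (n : nat).
Implicit Types X V : 'M[R]_n.

Lemma symmetricmxP X : reflect (X^T = X) (X \is symmetricmx).
Proof.
apply: (iffP (is_hermitianmxP _ _ _)); rewrite expr0 scale1r map_mx_id //.
Qed.

Lemma spectraplex_segment (t : R) X V : 0 <= t <= 1 ->
  spectraplex X -> spectraplex V -> spectraplex ((1 - t) *: X + t *: V).
Proof.
move=> /andP[t0 t1] [trX [/symmetricmxP sX pX]] [trV [/symmetricmxP sV pV]].
split; first by rewrite mxtraceD !mxtraceZ trX trV; ring.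
split; first by apply/symmetricmxP; rewrite linearD /= !linearZ /= sX sV.
move=> x; rewrite mulmxDr mulmxDl -!scalemxAr -!scalemxAl mxE.
by apply: addr_ge0; rewrite mxE mulr_ge0 ?subr_ge0.
Qed.

(** Up to the factor 1/n this is [e *m e^T], whose trace is n and whose quadratic form at [x] is the
    square of [e^T *m x]. *)
Lemma init_iterate_spectraplex : (0 < n)%N -> spectraplex (init_iterate R n).
Proof.
move=> n0; rewrite /init_iterate; set e := const_mx 1.
have nE : n%:R != 0 :> R by rewrite pnatr_eq0 -lt0n.
split.
  rewrite mxtraceZ (_ : \tr _ = n%:R) ?mulVf //.
  rewrite /mxtrace (eq_bigr (fun=> 1)) ?sumr_const ?card_ord // => i _.
  by rewrite !mxE big_ord1 !mxE mulr1.
split; first by apply/symmetricmxP; rewrite linearZ /= trmx_mul trmxK.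
move=> x; rewrite -scalemxAr -scalemxAl mxE mulr_ge0 ?invr_ge0 ?ler0n //.
rewrite mulmxA -(mulmxA (x^T *m e)) mxE big_ord1.
have -> : (x^T *m e) 0 0 = (e^T *m x) 0 0 by rewrite -[x in RHS]trmxK -trmx_mul [RHS]mxE.
by rewrite -expr2 sqr_ge0.
Qed.

End Spectraplex.

(** * Pivots, the bisector and the line search, in coordinates centred at [b] *)

Section TriangleAlgorithm.
Variables (R : realType) (m n : nat) (S : 'I_m -> 'M[R]_n) (b : 'cV[R]_m).
Implicit Types X V : 'M[R]_n.

Let gap X : 'cV[R]_m := pvec S X - b.

Lemma pvec_segment (t : R) X V :
  pvec S ((1 - t) *: X + t *: V) = (1 - t) *: pvec S X + t *: pvec S V.
Proof.
apply/matrixP => i j.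
by rewrite !mxE /mxdot mulmxDr -!scalemxAr mxtraceD !mxtraceZ.
Qed.

Lemma gap_segment (t : R) X V :
  gap ((1 - t) *: X + t *: V) = (1 - t) *: gap X + t *: gap V.
Proof. by rewrite /gap pvec_segment segment_subr. Qed.

(** [pivot_mx] is the adjoint of the linear map [pvec S] applied to the gap, so the pivot test on
    matrices becomes one on vectors. *)
Lemma mxdot_pivot_mx X V : mxdot (pivot_mx S b X) V = dotv (gap X) (pvec S V).
Proof.
rewrite /mxdot /pivot_mx mulmx_suml raddf_sum; apply: eq_bigr => i _ /=.
by rewrite -scalemxAl mxtraceZ !mxE.
Qed.

(** Expand |u + b|^2 with u = [gap X]. This form serves both the pivot test and the position of [b]
    relative to the bisector. *)
Lemma bisector_level X :
  2^-1 * (enorm (pvec S X) ^+ 2 - enorm b ^+ 2) =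
  dotv (gap X) b + 2^-1 * enorm (gap X) ^+ 2.
Proof.
rewrite !sqr_enorm /gap !(dotvDl, dotvDr, dotvNl, dotvNr) (dotvC b).
by field.
Qed.

Lemma pivotP X V : is_pivot S b X V <->
  spectraplex V /\ dotv (gap X) (gap V) <= 2^-1 * enorm (gap X) ^+ 2.
Proof.
rewrite /is_pivot bisector_level mxdot_pivot_mx.
have -> : pvec S V = gap V + b by rewrite subrK.
by rewrite dotvDr (addrC (dotv (gap X) b)) lerD2r.
Qed.

(** The squared distance is a quadratic polynomial in the step, hence attains its minimum on [0, 1];
    squaring does not change the minimisers. *)
Lemma step_size_exists X V : exists alpha, is_step_size S b X V alpha.
Proof.
pose q (t : R) := (1 - t) ^+ 2 * dotv (gap X) (gap X)
  + 2 * t * (1 - t) * dotv (gap X) (gap V) + t ^+ 2 * dotv (gap V) (gap V).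
pose P : {poly R} := (1 - 'X) ^+ 2 * (dotv (gap X) (gap X))%:P
  + 2 *: 'X * (1 - 'X) * (dotv (gap X) (gap V))%:P
  + 'X ^+ 2 * (dotv (gap V) (gap V))%:P.
have qP : q = horner P by apply/funext => t; rewrite !hornerE.
have cq : {within `[0, 1 : R], continuous q}.
  by apply: continuous_subspaceT => t; rewrite qP; exact: continuous_horner.
have [alpha + amin] := EVT_min ler01 cq.
rewrite in_itv /= => a01; exists alpha; split=> // beta b01.
rewrite !segment_subr ler_enorm !dotv_segment.
by apply: amin; rewrite in_itv.
Qed.

(** * Decrease of the gap, iteration bound and correctness of the outputs *)

Section Convergence.
Variables (eps rho : R).
Hypotheses (eps01 : 0 < eps < 1) (radius : is_radius S b rho).

Lemma radius_ge0 : 0 <= rho.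
Proof. by case: radius => -[X _ <-] _; exact: enorm_ge0. Qed.

Lemma gap_le_radius X : spectraplex X -> enorm (gap X) <= rho.
Proof.
by case: radius => _ ub sX; apply: ub; exists X; rewrite // -enormN opprB.
Qed.

Lemma sqr_gap_le_radius X : spectraplex X -> enorm (gap X) ^+ 2 <= rho ^+ 2.
Proof.
by move=> sX; rewrite ler_pXn2r ?nnegrE ?enorm_ge0 ?radius_ge0 ?gap_le_radius.
Qed.

(** With a zero radius the gap and the tolerance both vanish, so the stopping test would succeed. *)
Lemma radius_gt0 X : spectraplex X -> ~ (enorm (gap X) <= eps * rho) -> 0 < rho.
Proof.
move=> sX nle; rewrite lt0r radius_ge0 andbT; apply/eqP => r0; apply: nle.
by have := gap_le_radius sX; rewrite r0 mulr0.
Qed.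

(** This is d' <= d - d^2 / 4 for d = |u|^2 / rho^2, cleared of denominators. *)
Lemma pivot_step_decrease X V alpha : 0 < rho -> spectraplex X ->
    is_pivot S b X V -> is_step_size S b X V alpha ->
  4 * rho ^+ 2 * enorm (gap ((1 - alpha) *: X + alpha *: V)) ^+ 2 <=
  enorm (gap X) ^+ 2 * (4 * rho ^+ 2 - enorm (gap X) ^+ 2).
Proof.
move=> rho0 sX /pivotP[sV uv] [_ amin].
have D1 := sqr_gap_le_radius sX; have V1 := sqr_gap_le_radius sV.
have P0 : 0 < rho ^+ 2 by rewrite exprn_gt0.
set D := enorm (gap X) ^+ 2 in uv D1 *; set P := rho ^+ 2 in D1 V1 P0 *.
have D0 : 0 <= D by rewrite exprn_ge0 ?enorm_ge0.
(* The minimiser of (1 - t) D + t^2 P; it is at most 1 because D <= P. The exact line search does at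
   least as well as this step. *)
pose t := D / (2 * P).
have tP : 2 * t * P = D by rewrite /t; field; rewrite gt_eqF.
have t0 : 0 <= t by rewrite divr_ge0 // mulr_ge0 // ltW.
have t1 : t <= 1 by rewrite ler_pdivrMr; lra.
have /amin : 0 <= t <= 1 by rewrite t0.
rewrite !segment_subr -!gap_segment ler_enorm -!sqr_enorm => le_t.
have : enorm (gap ((1 - t) *: X + t *: V)) ^+ 2 <= (1 - t) * D + t ^+ 2 * P.
  rewrite sqr_enorm gap_segment dotv_segment -!sqr_enorm -/D.
  (* The pivot inequality bounds the cross term by t (1 - t) D, which adds up with (1 - t)^2 D to (1
     - t) D. *)
  have : 2 * t * (1 - t) * dotv (gap X) (gap V) <= 2 * t * (1 - t) * (2^-1 * D).
    by rewrite ler_wpM2l // mulr_ge0 ?subr_ge0 // mulr_ge0.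
  have : t ^+ 2 * enorm (gap V) ^+ 2 <= t ^+ 2 * P by rewrite ler_wpM2l ?sqr_ge0.
  by move=> *; lra.
move=> /(le_trans le_t).
rewrite -(ler_pM2l (_ : 0 < 4 * P)) ?mulr_gt0 // => /le_trans; apply.
by rewrite le_eqVlt -{2 3 4}tP; apply/orP; left; apply/eqP; rewrite -tP; ring.
Qed.

Hypothesis n_gt0 : (0 < n)%N.

(** The second part says 1/d >= 1 + k/4, which at k = 0 is d <= 1. The third counts [k.+1] passes so
    as to cover the pass that leaves [X]. *)
Lemma reach_iterate k X : run S b (eps * rho) k (Iterate X) ->
  [/\ spectraplex X, enorm (gap X) ^+ 2 * k.+4%:R <= 4 * rho ^+ 2
    & k.+1%:R * eps ^+ 2 <= 4].
Proof.
elim: k X => [|k IH] X run_X.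
  inversion run_X; subst.
  have sX := init_iterate_spectraplex R n_gt0; split=> //.
    by have := sqr_gap_le_radius sX; lra.
  by case/andP: eps01 => *; nra.
inversion run_X as [|k0 Y c run_Y pass_Y]; subst.
have [sY inv _] := IH _ run_Y.
inversion pass_Y as [|V alpha nle piv step|]; subst.
have rho0 := radius_gt0 sY nle.
have dec := pivot_step_decrease rho0 sY piv step.
have sqr_lt : eps ^+ 2 * rho ^+ 2 < enorm (gap Y) ^+ 2.
  rewrite -exprMn ltr_pXn2r ?nnegrE ?enorm_ge0 //;
    first by rewrite ltNge; apply/negP.
  by case/andP: eps01 => *; rewrite mulr_ge0 ?ltW.
have D1 := sqr_gap_le_radius sY.
have P0 : 0 < rho ^+ 2 by rewrite exprn_gt0.
have D0 : 0 <= enorm (gap Y) ^+ 2 by rewrite sqr_ge0.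
have K0 : 0 <= k%:R :> R by rewrite ler0n.
case: step => a01 _; split.
- by apply: spectraplex_segment => //; case: piv.
- move: dec inv D1 P0 D0; set D' := enorm (gap _) ^+ 2.
  set D := enorm (gap Y) ^+ 2; set P := rho ^+ 2 => dec inv D1 P0 D0.
  have -> : k.+1.+4%:R = k.+4%:R + 1 :> R by rewrite -natr1.
  (* By [dec] and [inv], 4 P D' (k + 5) <= (4 P + D) (4 P - D) = 16 P^2 - D^2. *)
  rewrite -(ler_pM2l (_ : 0 < 4 * P)) ?mulr_gt0 // mulrA.
  apply: (le_trans (ler_wpM2r _ dec)); first by rewrite addr_ge0 ?ler0n.
  have : D * k.+4%:R * (4 * P - D) <= 4 * P * (4 * P - D).
    by rewrite ler_wpM2r // subr_ge0; lra.
  by move: (sqr_ge0 D); nra.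
- have K4 : k.+4%:R = k%:R + 4 :> R by rewrite -natrD addn4.
  have K2 : k.+2%:R = k%:R + 2 :> R by rewrite -natrD addn2.
  rewrite K2; rewrite K4 in inv.
  (* The failed test at [Y] and [inv] give (k + 4) eps^2 <= 4, which leaves room for k + 2. *)
  rewrite -(ler_pM2r P0).
  have : (k%:R + 4) * (eps ^+ 2 * rho ^+ 2) <= (k%:R + 4) * enorm (gap Y) ^+ 2.
    by rewrite ler_wpM2l ?addr_ge0 // ltW.
  by move: (mulr_ge0 (sqr_ge0 eps) (ltW P0)); nra.
Qed.

(** Whatever the last configuration is, the one before it is an iterate, to which [reach_iterate]
    applies. *)
Lemma reach_bound k c : run S b (eps * rho) k c -> k%:R <= 4 / eps ^+ 2.
Proof.
have e0 : 0 < eps ^+ 2 by case/andP: eps01 => *; rewrite exprn_gt0.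
case=> [|{}k X {}c /reach_iterate[_ _ bound] _]; last by rewrite ler_pdivlMr.
by rewrite divr_ge0 ?ltW.
Qed.

Lemma pass_total X : exists c, pass S b (eps * rho) X c.
Proof.
have [le|/negP nle] := boolP (enorm (gap X) <= eps * rho).
  by exists (Solution X); exact: pass_solution.
have [[V piv]|nopiv] := pselect (exists V, is_pivot S b X V).
  by have [alpha step] := step_size_exists X V; eexists; exact: pass_pivot step.
by exists (Separator (bisector S b X)); exact: pass_witness.
Qed.

(** The failed stopping test makes the normal [gap X] nonzero, hence [b] strictly below the level;
    negating the pivot test puts the spectrahull strictly above it. *)
Lemma bisector_separates X : ~ (enorm (gap X) <= eps * rho) ->
    ~ (exists V, is_pivot S b X V) ->
  separating_hyperplane (bisector S b X) b (spectrahull S).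
Proof.
move=> nle nopiv.
have gap0 : 0 < enorm (gap X).
  rewrite ltNge; apply/negP => le0; apply: nle; apply: le_trans le0 _.
  by case/andP: eps01 => /ltW e0 _; rewrite mulr_ge0 // radius_ge0.
exists (gap X), (2^-1 * (enorm (pvec S X) ^+ 2 - enorm b ^+ 2)); split=> //.
- by apply: contraTneq gap0 => ->; rewrite enorm0 ltxx.
- by rewrite bisector_level ltrDl mulr_gt0 ?exprn_gt0 ?invr_gt0.
- move=> _ [V sV <-]; rewrite -mxdot_pivot_mx ltNge; apply/negP => le.
  by apply: nopiv; exists V.
Qed.

End Convergence.
End TriangleAlgorithm.

Theorem mainTheorem2 :
  exists C : nat,
    forall (R : realType) (m n : nat) (S : 'I_m -> 'M[R]_n) (b : 'cV[R]_m)
      (eps rho : R),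
      (0 < n)%N ->
      (forall i : 'I_m, S i \is symmetricmx) ->
      0 < eps < 1 ->
      is_radius S b rho ->
      let reach := run S b (eps * rho) in
      [/\ (* the number of passes of any execution is bounded *)
          forall (k : nat) (c : config R m n),
            reach k c -> k%:R <= C%:R / eps ^+ 2,
          (* an execution that has not halted can always continue *)
          forall (k : nat) (X : 'M[R]_n),
            reach k (Iterate X) -> exists c, pass S b (eps * rho) X c,
          forall (k : nat) (X : 'M[R]_n),
            reach k (Solution X) ->
            spectraplex X /\ enorm (pvec S X - b) <= eps * rho
        & forall (k : nat) (H : set 'cV[R]_m),
            reach k (Separator H) ->
            separating_hyperplane H b (spectrahull S)].
Proof.
exists 4 => R m n S b eps rho n_gt0 _ eps01 radius reach; split.
- by move=> k c; exact: reach_bound.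
- by move=> k X _; exact: pass_total.
- move=> k X run_X; inversion run_X as [|j Y c run_Y pass_Y]; subst.
  inversion pass_Y; subst.
  (* The halting pass returns the current iterate unchanged, so membership is inherited from the
     invariant. *)
  by have [] := reach_iterate eps01 radius n_gt0 run_Y.
- move=> k H run_H; inversion run_H as [|j Y c run_Y pass_Y]; subst.
  by inversion pass_Y; subst; exact: (bisector_separates eps01 radius).
Qed.
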